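(* Let $r$ be an even positive integer and let $p>1$ be an integer with $p\mid\frac r2$. For $n\ge 0$ let $f_{r,p,n}(u,v,w)=\sum_{\pi\in I_{r,p,n}}u^{\mathrm{fix}(\pi)}v^{\mathrm{exc}_A(\pi)}w^{\mathrm{csum}(\pi)}$. Then for all $n\ge1$ $$f_{r,p,n}(u,v,w)=u\left(1+w^{\frac r2}\right)f_{r,p,n-1}(u,v,w)+(n-1)\left(v+(r-1)w^{r}\right)f_{r,p,n-2}(u,v,w),$$ and $$f_{r,p,n}(u,v,w)=\sum_{j=\lceil n/2\rceil}^n(n-j)!\binom{n}{n-j,\ n-j,\ 2j-n}\frac{u^{2j-n}\left(v+(r-1)w^r\right)^{n-j}}{2^{n-j}}\left(1+w^{\frac r2}\right)^{2j-n}.$$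
   Context: Let $\Sigma=\{i^{[c]} : 1\le i\le n,\ c\in\mathbb{Z}_r\}$ be the set $[n]=\{1,\dots,n\}$ coloured with colours $0,1,\dots,r-1$; write $i$ for $i^{[0]}$. The group $G_{r,n}=\mathbb{Z}_r\wr S_n$ of coloured permutations consists, under composition, of all bijections $\sigma:\Sigma\to\Sigma$ for which there are a permutation $|\sigma|\in S_n$ and integers $z_1(\sigma),\dots,z_n(\sigma)\in\{0,\dots,r-1\}$ with $\sigma(i^{[c]})=(|\sigma|(i))^{[c+z_i(\sigma)]}$ (colours added modulo $r$). Put $\mathrm{csum}(\sigma)=\sum_{i=1}^n z_i(\sigma)$, an integer. For $p\mid r$, $G_{r,p,n}=\{\sigma\in G_{r,n} : \mathrm{csum}(\sigma)\equiv 0 \bmod p\}$, and $I_{r,p,n}$ is the set of its involutions, i.e. elements $\pi$ with $\pi^2=1$ (the identity included). By convention $f_{r,p,0}=1$ and $f_{r,p,-1}=0$. The colour order on $\Sigma$ is $1^{[r-1]}<\cdots<n^{[r-1]}<1^{[r-2]}<\cdots<n^{[r-2]}<\cdots<1<\cdots<n$. Define $\mathrm{exc}_A(\sigma)=|\{i\in[n-1] : \sigma(i)>i\}|$ (comparison in the colour order). $\mathrm{fix}(\sigma)$ denotes the number of absolute fixed points, i.e. of $i\in[n]$ with $|\sigma|(i)=i$. Multinomial coefficients: $\binom{n}{a,b,c}=\frac{n!}{a!\,b!\,c!}$. *)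

(* Defs.v *)
From mathcomp Require Import all_boot all_order all_algebra all_fingroup.
From mathcomp.multinomials Require Import mpoly.

Set Implicit Arguments.
Unset Strict Implicit.
Unset Printing Implicit Defensive.

Import GRing.Theory.
Local Open Scope ring_scope.

(* The coloured symbol (i+1)^[c] is the pair (i, c): the letters 1, ..., n are
   the ordinals 0, ..., n-1.  Since 'Z_r is the ring of integers modulo r only
   when 1 < r, every definition below is meant for 1 < r. *)
Notation symbol r n := ('I_n * 'Z_r)%type.

Definition uncoloured (r n : nat) (i : 'I_n) : symbol r n := (i, 0).

Definition Grn (r n : nat) : {set {perm symbol r n}} :=
  [set s : {perm symbol r n} | [exists t : 'S_n, exists z : {ffun 'I_n -> 'Z_r},
    forall x : symbol r n, s x == (t x.1, x.2 + z x.1)]].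

(* |s| and z_i(s), for s in Grn; see [abs_colour_uniq]. *)
Definition abs_perm (r n : nat) (s : {perm symbol r n}) (i : 'I_n) : 'I_n :=
  (s (uncoloured r i)).1.

Definition colour (r n : nat) (s : {perm symbol r n}) (i : 'I_n) : 'Z_r :=
  (s (uncoloured r i)).2.

Lemma abs_colour_uniq (r n : nat) (s : {perm symbol r n})
    (t : 'S_n) (z : {ffun 'I_n -> 'Z_r}) :
    (forall x, s x = (t x.1, x.2 + z x.1)) ->
  forall i, t i = abs_perm s i /\ z i = colour s i.
Proof. by move=> sE i; rewrite /abs_perm /colour sE /= add0r. Qed.

(* A sum of natural numbers, each colour being read in {0, ..., r-1}. *)
Definition csum (r n : nat) (s : {perm symbol r n}) : nat :=
  (\sum_(i < n) colour s i)%N.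

Definition Grpn (r p n : nat) : {set {perm symbol r n}} :=
  [set s in Grn r n | (p %| csum s)%N].

Definition Irpn (r p n : nat) : {set {perm symbol r n}} :=
  [set s in Grpn r p n | (s ^+ 2 == 1)%g].

(* 1^[r-1] < ... < n^[r-1] < 1^[r-2] < ... < n^[r-2] < ... < 1 < ... < n *)
Definition colour_lt (r n : nat) (x y : symbol r n) : bool :=
  ((y.2 < x.2) || (x.2 == y.2) && (x.1 < y.1))%N.

(* i.+1 < n says that the letter i+1 lies in {1, ..., n-1}. *)
Definition excA (r n : nat) (s : {perm symbol r n}) : nat :=
  #|[set i : 'I_n | (i.+1 < n)%N
      && colour_lt (uncoloured r i) (s (uncoloured r i))]|.

Definition nfix (r n : nat) (s : {perm symbol r n}) : nat :=
  #|[set i : 'I_n | abs_perm s i == i]|.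

Definition u : {mpoly rat[3]} := 'X_(@Ordinal 3 0 isT).
Definition v : {mpoly rat[3]} := 'X_(@Ordinal 3 1 isT).
Definition w : {mpoly rat[3]} := 'X_(@Ordinal 3 2 isT).

(* The index is an integer so that f_{r,p,-1} = 0 makes sense; at index 0 the
   sum ranges over the only permutation of the empty set and is 1. *)
Definition f_inv (r p : nat) (m : int) : {mpoly rat[3]} :=
  match m with
  | Posz n => \sum_(s in Irpn r p n) u ^+ nfix s * v ^+ excA s * w ^+ csum s
  | Negz _ => 0
  end.

Definition trinomial (n a b c : nat) : rat :=
  n`!%:R / (a`!%:R * b`!%:R * c`!%:R).

(* Main.v *)
(* An involution sigma sending i to j^[c] sends j to i^[-c], so it is a
   collection of fixed letters coloured 0 or r/2 and of 2-cycles carrying one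
   colour c in Z_r.  The weight u^fix v^exc w^csum is a product of local weights
   over the letters: a fixed letter contributes u (1 + w^(r/2)) in total, and a
   2-cycle contributes v when c = 0 and w^r for each of the r - 1 other colours.
   The condition p | csum is automatic because p divides r/2.  Removing a letter
   from the support, alone or together with its partner, gives the recurrence;
   the closed form counts the partial matchings of [n] by their size. *)
Require Import Defs.
From mathcomp Require Import all_boot all_order all_algebra all_fingroup.
From mathcomp.multinomials Require Import mpoly.
From mathcomp Require Import zify ring.

Set Implicit Arguments.
Unset Strict Implicit.
Unset Printing Implicit Defensive.

Import GRing.Theory.
Local Open Scope ring_scope.

(** * Weighted sums over coloured involutions supported in a finite set *)

Section ColouredInvolutions.

Variables (I : finType) (Z : finZmodType) (R : comPzRingType).
Implicit Types (A : {set I}) (e : {ffun I -> I * Z}).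

(* e k is the image of the uncoloured letter k, which is k itself outside A. *)
Definition coloured_invol A e :=
  [forall k, if k \in A then e (e k).1 == (k, - (e k).2) else e k == (k, 0)].

Lemma coloured_involP A e :
  reflect [/\ {in A, forall k, e (e k).1 = (k, - (e k).2)}
            & forall k, k \notin A -> e k = (k, 0)]
          (coloured_invol A e).
Proof.
apply: (iffP forallP) => [eP | [eA eN] k].
  by split=> k kA; apply/eqP; have := eP k; rewrite ?kA ?(negPf kA).
by case: ifPn => kA; [rewrite eA | rewrite eN].
Qed.

Variable H : I -> I * Z -> R.

Definition invol_sum A : R :=
  \sum_(e | coloured_invol A e) \prod_(k in A) H k (e k).

Lemma invol_sum_set0 : invol_sum set0 = 1.
Proof.
rewrite /invol_sum (big_pred1 [ffun k => (k, 0)]) ?big_set0 // => e.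
apply/coloured_involP/eqP => [[_ eN] | ->].
  by apply/ffunP => k; rewrite ffunE eN ?inE.
by split=> k; rewrite ?inE ?ffunE.
Qed.

(** Once [i] goes to [(j, c)], the image of [j] is forced to be [(i, - c)], and the other letters
    carry an arbitrary coloured involution of [A :\ i :\ j]. The factor 1 for [i = j] keeps a fixed
    letter from being weighted twice. *)
Lemma invol_sum_fiber A i j c : i \in A -> j \in A -> (i = j -> c = - c) ->
  \sum_(e | coloured_invol A e && (e i == (j, c))) \prod_(k in A) H k (e k)
    = H i (j, c) * (if i == j then 1 else H j (i, - c)) * invol_sum (A :\ i :\ j).
Proof.
move=> iA jA ijc.
pose ext e : {ffun I -> I * Z} :=
  [ffun k => if k == i then (j, c) else if k == j then (i, - c) else e k].
pose res e : {ffun I -> I * Z} :=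
  [ffun k => if (k == i) || (k == j) then (k, 0) else e k].
(* [ext] inserts the cycle through [i] and [j]; [res] erases it by making both letters trivial, as
   letters outside the support must be. *)
rewrite (reindex_onto ext res) /=; last first.
  move=> e /andP[/coloured_involP[eA _] /eqP ei]; apply/ffunP=> k.
  rewrite !ffunE; case: eqVneq => [-> // | ki].
  by case: eqVneq => [-> | //]; have := eA _ iA; rewrite ei.
rewrite /invol_sum big_distrr /=; apply: eq_big => [e | e _].
  apply/idP/idP.
  - move=> /andP[/andP[/coloured_involP[eA eN] _] /eqP rE].
    have ei : e i = (i, 0) by rewrite -rE ffunE eqxx.
    have ej : e j = (j, 0) by rewrite -rE ffunE eqxx orbT.
    apply/coloured_involP; split=> k; rewrite !inE.
      move=> /and3P[kj ki kA]; have := eA _ kA.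
      rewrite [ext e k]ffunE (negPf ki) (negPf kj) ffunE.
      case: (eqVneq (e k).1 i) => [_ [jk _] | _]; first by rewrite jk eqxx in kj.
      by case: (eqVneq (e k).1 j) => [_ [ik _] | //]; rewrite ik eqxx in ki.
    case: (eqVneq k j) => [-> // | kj]; case: (eqVneq k i) => [-> // | ki] /= kA.
    by have := eN _ kA; rewrite ffunE (negPf ki) (negPf kj).
  - move=> /coloured_involP[eA eN].
    have ei : e i = (i, 0) by rewrite eN ?inE ?eqxx ?andbF.
    have ej : e j = (j, 0) by rewrite eN ?inE ?eqxx.
    apply/andP; split; last first.
      apply/eqP/ffunP=> k; rewrite !ffunE.
      by case: eqVneq => [-> // | _]; case: eqVneq => [-> |].
    apply/andP; split; last by rewrite ffunE eqxx.
    apply/coloured_involP; split=> k kA; last first.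
      rewrite ffunE; case: eqVneq => [ki | _]; first by rewrite ki iA in kA.
      case: eqVneq => [kj | _]; first by rewrite kj jA in kA.
      by rewrite eN // !inE (negPf kA) !andbF.
    rewrite [ext e k]ffunE; case: (eqVneq k i) => [-> | ki].
      by rewrite ffunE eqxx /=; case: eqVneq => [ji | //]; rewrite ji -ijc.
    case: (eqVneq k j) => [-> | kj]; first by rewrite ffunE eqxx /= opprK.
    (* [e] fixes [i] and [j], so neither can be the partner of the third letter [k]; hence [ext]
       leaves that partner's image unchanged. *)
    have ek : e (e k).1 = (k, - (e k).2) by apply: eA; rewrite !inE ki kj.
    rewrite ffunE; case: eqVneq => [eki | _].
      by move: ek; rewrite eki ei => -[/eqP]; rewrite eq_sym (negPf ki).
    case: eqVneq => [ekj | //].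
    by move: ek; rewrite ekj ej => -[/eqP]; rewrite eq_sym (negPf kj).
rewrite (big_setD1 i) //= ffunE eqxx -!mulrA; congr (_ * _).
case: (eqVneq i j) => [ij | ij].
  rewrite mul1r -ij [A :\ i :\ i]setDDl setUid.
  apply: eq_bigr => k; rewrite !inE => /andP[ki _].
  by rewrite ffunE (negPf ki) -ij (negPf ki).
rewrite (big_setD1 j) ?inE 1?eq_sym ?ij //= ffunE eqxx eq_sym (negPf ij).
congr (_ * _); apply: eq_bigr => k; rewrite !inE => /and3P[kj ki _].
by rewrite ffunE (negPf ki) (negPf kj).
Qed.

(** Split by the value [(j, c)] of [e i]. The fibre is empty when [j = i] and [c] is not its own
    opposite, and when [j] lies outside [A], since such a letter is sent to itself. *)
Lemma invol_sum_rec A i : i \in A ->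
  invol_sum A = (\sum_(c | c == - c) H i (i, c)) * invol_sum (A :\ i)
    + \sum_(j in A :\ i)
        (\sum_c H i (j, c) * H j (i, - c)) * invol_sum (A :\ i :\ j).
Proof.
move=> iA; rewrite {1}/invol_sum (partition_big (fun e => e i) predT) //=.
rewrite -(pair_big predT predT (fun j c => \sum_(e | coloured_invol A e
  && (e i == (j, c))) \prod_(k in A) H k (e k))) /= (bigD1 i) //=.
congr (_ + _).
  rewrite big_distrl /= (bigID (fun c => c == - c)) /= [X in _ + X]big1 ?addr0.
    apply: eq_bigr => c /eqP cN.
    by rewrite invol_sum_fiber // eqxx mulr1 setDDl setUid.
  move=> c cN; rewrite big_pred0 // => e; apply/negP.
  move=> /andP[/coloured_involP[eA _] /eqP ei]; case/negP: cN; apply/eqP.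
  by have := eA i iA; rewrite ei /= ei => -[].
rewrite (bigID (mem A)) /= [X in _ + X]big1 ?addr0.
  apply: eq_big => [j | j /andP[ji jA]]; first by rewrite !inE.
  rewrite big_distrl /=; apply: eq_bigr => c _; rewrite invol_sum_fiber //.
    by rewrite eq_sym (negPf ji).
  by move=> ij; rewrite ij eqxx in ji.
move=> j /andP[ji jA]; apply: big1 => c _; rewrite big_pred0 // => e; apply/negP.
move=> /andP[/coloured_involP[eA eN] /eqP ei]; case/negP: ji; apply/eqP.
by have := eA i iA; rewrite ei /= eN // => -[].
Qed.

(** The matching polynomial of the complete graph on [n] vertices, with weight [a] per unmatched
    vertex and [b] per edge. *)
Fixpoint invol_poly (a b : R) n :=
  if n is m.+1 then
    a * invol_poly a b m + (if m is k.+1 then m%:R * b * invol_poly a b k else 0)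
  else 1.

Lemma invol_sumE (a b : R) A :
    (forall i, \sum_(c | c == - c) H i (i, c) = a) ->
    (forall i j, i != j -> \sum_c H i (j, c) * H j (i, - c) = b) ->
  invol_sum A = invol_poly a b #|A|.
Proof.
move=> Ha Hb; have [n] := ubnP #|A|; elim: n A => // n IHn A.
have [-> _ | [i iA]] := set_0Vmem A; first by rewrite invol_sum_set0 cards0.
rewrite (cardsD1 i) iA add1n ltnS => An /=.
rewrite (invol_sum_rec iA) Ha IHn //; congr (_ + _).
(* All summands agree; the predecessor of 0 does no harm, as the sum is then empty. *)
transitivity (\sum_(j in A :\ i) b * invol_poly a b #|A :\ i|.-1).
  apply: eq_bigr => j jA.
  have ij : i != j by move: jA; rewrite !inE eq_sym => /andP[].
  have Aj := cardsD1 j (A :\ i); rewrite jA add1n in Aj.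
  by rewrite Hb // Aj /= IHn //; apply: ltn_trans An; rewrite Aj.
rewrite sumr_const; case: #|_| => [|m]; first by rewrite mulr0n.
by rewrite /= -mulrA mulr_natl.
Qed.

End ColouredInvolutions.

(** * Counting partial matchings by their number of pairs *)

Section ClosedForm.

Variable F : numFieldType.

Definition matching_number n k : F :=
  if (k.*2 <= n)%N then n`!%:R / (k`!%:R * (n - k.*2)`!%:R * 2 ^+ k) else 0.

Lemma matching_number0 n : matching_number n 0 = 1.
Proof.
rewrite /matching_number /= subn0 expr0 mulr1 mul1r divff //.
by rewrite Num.Theory.pnatr_eq0 -lt0n fact_gt0.
Qed.

(** Combinatorially, a chosen point among [n.+2] is either unmatched or paired with one of [n.+1]
    others; the proof checks the identity on factorials. *)
Lemma matching_numberS n k :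
  matching_number n.+2 k.+1
    = matching_number n.+1 k.+1 + n.+1%:R * matching_number n k.
Proof.
rewrite /matching_number doubleS !ltnS.
have [kn | nk] := leqP k.*2 n; last by rewrite ltnNge (ltnW nk) mulr0 addr0.
have fact_neq0 m : m`!%:R != 0 :> F.
  by rewrite Num.Theory.pnatr_eq0 -lt0n fact_gt0.
have nat1_neq0 m : 1 + m%:R != 0 :> F by rewrite nat1r Num.Theory.pnatr_eq0.
have exp2_neq0 : 2 ^+ k != 0 :> F by rewrite expf_neq0 ?Num.Theory.pnatr_eq0.
have [m ->] : exists m, n = (k.*2 + m)%N by exists (n - k.*2)%N; lia.
rewrite !subSS addKn.
(* For [m = 0], [k.+1] pairs do not fit into [n.+1] points and the first term is 0. *)
case: m => [|m].
  rewrite addn0 ltnn add0r !factS exprS !natrM -!mul2n; field.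
  by rewrite !fact_neq0 exp2_neq0; apply: nat1_neq0.
have -> : (k.*2 < k.*2 + m.+1)%N by lia.
have -> : (k.*2 + m.+1 - k.*2.+1)%N = m by lia.
rewrite !factS !natrM exprS -!mul2n; field.
by rewrite !fact_neq0 exp2_neq0 !nat1_neq0.
Qed.

Lemma matching_number_gt n k : (n < k.*2)%N -> matching_number n k = 0.
Proof. by rewrite /matching_number ltnNge => /negPf ->. Qed.

(** The free bound [N] lets the induction take the sum for [n.+1] up to [N.+1] and the one for [n]
    up to [N], so that they align once the term [k = 0] is split off. *)
Lemma invol_poly_closed (K : comAlgType F) (a b : K) n N : (n./2 < N)%N ->
  invol_poly a b n
    = \sum_(k < N) matching_number n k *: (a ^+ (n - k.*2) * b ^+ k).
Proof.
elim/ltn_ind: n N => -[|[|n]] IHn [|N] // nN;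
  rewrite big_ord_recl matching_number0 scale1r expr0 mulr1 /=.
- by rewrite big1 ?addr0 // => k _; rewrite matching_number_gt ?scale0r.
- rewrite big1 ?addr0 ?mulr1 ?expr1 // => k _.
  by rewrite matching_number_gt ?scale0r.
rewrite -[X in a * X]/(invol_poly a b n.+1).
rewrite (IHn n.+1 _ N.+1) ?(IHn n _ N) //; last by move: nN; lia.
rewrite big_ord_recl matching_number0 scale1r expr0 mulr1 subn0 /= mulrDr -exprS.
rewrite -addrA; congr (_ + _).
rewrite !big_distrr -big_split /=; apply: eq_bigr => k _.
rewrite /bump add1n doubleS matching_numberS scalerDl !subSS; congr (_ + _).
  (* When [n <= k.*2] the exponent of [a] is truncated, but the coefficient vanishes. *)
  have [kn | kn] := ltnP k.*2 n; last first.
    by rewrite matching_number_gt ?scale0r ?mulr0 // doubleS.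
  by rewrite -scalerAr mulrA -exprS -subSn.
by rewrite -scalerA -scalerAr -mulrA mulr_natl scaler_nat scalerMnr exprS mulrCA.
Qed.

End ClosedForm.

(** * Opposites of colours and their integer representatives *)

Lemma Zr_eq0 r (c : 'Z_r) : (c == 0) = (c == 0 :> nat)%N.
Proof. by []. Qed.

Section Zr.

Variables (r : nat) (r_gt1 : (1 < r)%N).

Lemma Zr_lt (c : 'Z_r) : (c < r)%N.
Proof. by rewrite -[X in (_ < X)%N](Zp_cast r_gt1). Qed.

Lemma val_Zr_opp (c : 'Z_r) : nat_of_ord (- c) = if c == 0 then 0%N else (r - c)%N.
Proof.
move: c; case: r r_gt1 => [|[|m]] //= _ c; rewrite Zr_eq0.
case: eqP => [-> | /eqP]; first by rewrite subn0 modnn.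
by rewrite -lt0n => c0; rewrite modn_small // ltn_subrL c0.
Qed.

Lemma dvdn_Zr_addN (c : 'Z_r) : (r %| c + (- c)%R)%N.
Proof.
rewrite val_Zr_opp; case: eqP => [-> | _]; first exact: dvdn0.
by rewrite subnKC ?dvdnn // ltnW ?Zr_lt.
Qed.

Lemma Zr_eqN (c : 'Z_r) : ~~ odd r ->
  (c == - c) = (c == 0) || (c == r./2 :> nat)%N.
Proof.
move=> r_even; have := Zr_lt c.
rewrite -(inj_eq val_inj) [val (- c)]val_Zr_opp Zr_eq0 /=.
move: (nat_of_ord c) r_even => m; case: (eqVneq m 0%N) => [-> // | m0] /=.
by move=> r_even mr; apply/eqP/eqP; move: r_even m0 mr; lia.
Qed.

Lemma card_Zr : #|{: 'Z_r}| = r.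
Proof. by rewrite card_ord Zp_cast. Qed.

End Zr.

(** * Group involutions as coloured involutions of the letters *)

Section LetterValues.

Variables (r p n : nat).
Hypotheses (r_gt1 : (1 < r)%N) (r_even : ~~ odd r) (p_dvd : (p %| r./2)%N).

(** A fixed letter has colour 0 or [r./2], and the two colours of a 2-cycle add up to 0 or [r]; [p]
    divides all of these. *)
Lemma csum_dvd (e : {ffun 'I_n -> symbol r n}) :
  coloured_invol setT e -> (p %| \sum_(i < n) (e i).2)%N.
Proof.
move=> /coloured_involP[eT _]; pose t (i : 'I_n) := (e i).1.
have eK i : e (t i) = (i, - (e i).2) by apply: eT; rewrite inE.
have tK : involutive t by move=> i; rewrite /t eK.
have p_r : (p %| r)%N by rewrite -(even_halfK r_even) -muln2 dvdn_mulr.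
rewrite (bigID (fun i => t i == i)) dvdn_add //=.
  apply: dvdn_sum => i /eqP ti; have := eK i; rewrite ti.
  by move: (e i) => [j c] /= [_ /eqP]; rewrite Zr_eqN // => /orP[] /eqP -> //.
rewrite (bigID (fun i : 'I_n => (i < t i)%N)) /=.
(* Reindexing by [t] moves the larger letter of each 2-cycle onto the smaller one, so that their
   colours can be added. *)
rewrite [X in (_ + X)%N](reindex_inj (inv_inj tK)) /=.
rewrite [X in (_ + X)%N](eq_bigl (fun i : 'I_n => (t i != i) && (i < t i)%N));
  last first.
  move=> i; rewrite tK eq_sym; case: eqVneq => //= ti.
  by rewrite -leqNgt ltn_neqAle (inj_eq (@ord_inj n)) ?ti 1?eq_sym ?ti.
rewrite -big_split /=; apply: dvdn_sum => i _.
by rewrite eK; apply: dvdn_trans p_r _; apply: dvdn_Zr_addN.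
Qed.

Definition letter_values (s : {perm symbol r n}) : {ffun 'I_n -> symbol r n} :=
  [ffun i => s (uncoloured r i)].

Lemma GrnE s : s \in Grn r n -> forall x,
  s x = ((letter_values s x.1).1, x.2 + (letter_values s x.1).2).
Proof.
rewrite inE => /existsP[t /existsP[z /forallP sE]] x.
by rewrite ffunE (eqP (sE x)) (eqP (sE (uncoloured r x.1))) /= add0r.
Qed.

Lemma IrpnP (s : {perm symbol r n}) :
  reflect [/\ s \in Grn r n, (p %| csum s)%N & (s ^+ 2 = 1)%g] (s \in Irpn r p n).
Proof.
apply: (iffP setIdP) => [[/setIdP[? ?] /eqP ?] // | [? ? ?]].
by split; [apply/setIdP | apply/eqP].
Qed.

Lemma letter_values_inj : {in Irpn r p n &, injective letter_values}.
Proof.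
move=> s1 s2 /IrpnP[/GrnE s1E _ _] /IrpnP[/GrnE s2E _ _] eq12.
by apply/permP => x; rewrite s1E s2E eq12.
Qed.

Lemma letter_values_Irpn :
  letter_values @: Irpn r p n = [set e | coloured_invol setT e].
Proof.
apply/setP => e; rewrite [RHS]inE; apply/imsetP/idP => [[s sI ->] | eI].
  have [/GrnE sE _ s2] := IrpnP _ sI.
  apply/coloured_involP; split=> i; rewrite ?inE // => _.
  have : s (s (uncoloured r i)) = uncoloured r i.
    by rewrite -permM -[(s * s)%g]/(s ^+ 2)%g s2 perm1.
  have valE j : letter_values s j = s (uncoloured r j) by rewrite ffunE.
  rewrite -[s (uncoloured r i)]valE sE.
  case: (letter_values s (letter_values s i).1) => [j c]; move/eqP.
  by rewrite xpair_eqE addrC addr_eq0 => /andP[/eqP <- /eqP <-].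
have [eT _] := coloured_involP _ _ eI.
have eK i : e (e i).1 = (i, - (e i).2) by apply: eT; rewrite inE.
(* The extension of [e] to all symbols that commutes with shifting colours. *)
pose f (x : symbol r n) : symbol r n := ((e x.1).1, x.2 + (e x.1).2).
have fK : involutive f by case=> i c; rewrite /f /= eK /= addrK.
have tK : involutive (fun i => (e i).1) by move=> i; rewrite /= eK.
exists (perm (inv_inj fK)).
  apply/IrpnP; split; last first.
  - by apply/permP => x; rewrite expgS expg1 permM !permE fK.
  - rewrite /csum (eq_bigr (fun i => nat_of_ord (e i).2)); first exact: csum_dvd.
    by move=> i _; rewrite /colour permE /f add0r.
  rewrite inE; apply/existsP; exists (perm (inv_inj tK)); apply/existsP.
  exists [ffun i => (e i).2]; apply/forallP => x.
  by rewrite !permE !ffunE.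
by apply/ffunP => i; rewrite ffunE permE /f add0r -surjective_pairing.
Qed.

End LetterValues.

(** * Local weights and their sums over colours *)

Section Weights.

Variables (r n : nat) (R : comNzRingType) (a b c : R).
Hypotheses (r_gt1 : (1 < r)%N) (r_even : ~~ odd r).

(** A symbol exceeds the uncoloured letter [i] in the colour order only if it has colour 0 and a
    larger letter; this is the exponent of [b]. *)
Definition letter_weight (i : 'I_n) (x : symbol r n) : R :=
  a ^+ (x.1 == i) * b ^+ ((x.2 == 0) && (i < x.1)%N) * c ^+ x.2.

Lemma prod_letter_weight (s : {perm symbol r n}) :
  \prod_i letter_weight i (letter_values s i)
    = a ^+ nfix s * b ^+ excA s * c ^+ csum s.
Proof.
rewrite !big_split /= /nfix /excA /csum -!sum1dep_card -!prodrXr.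
rewrite [\prod_(i | abs_perm s i == i) _]big_mkcond.
rewrite [\prod_(i < n | (_ < n)%N && _) _]big_mkcond /=.
congr (_ * _ * _); apply: eq_bigr => i _; rewrite ffunE.
- by rewrite /abs_perm; case: eqP.
- rewrite /colour_lt [(uncoloured r i).2]/(0 : 'Z_r) ltn0 /= eq_sym; set x := s _.
  case: eqP => //= _; last by rewrite andbF.
  (* The bound [i.+1 < n] in [excA] comes from the letter [x.1] lying above [i]. *)
  case: (ltnP i x.1) => [ix|]; last by rewrite andbF.
  by rewrite (leq_ltn_trans ix (ltn_ord _)).
- by [].
Qed.

Lemma sum_fixed_weight i :
  \sum_(d : 'Z_r | d == - d) letter_weight i (i, d) = a * (1 + c ^+ r./2).
Proof.
have [h hE] : exists h : 'Z_r, h = r./2 :> nat.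
  exists (inZp r./2); rewrite /= modn_small // [X in (_ < X)%N]Zp_cast //.
  by rewrite ltn_half_double; move: r_gt1; lia.
have h_neq0 : h != 0 by rewrite Zr_eq0 hE; move: r_gt1; lia.
rewrite (bigD1 0) ?oppr0 //= (bigD1 h) /=; last by rewrite Zr_eqN // hE eqxx orbT.
rewrite big1 ?addr0 => [|d /andP[/andP[+ d0] /eqP dh]]; last first.
  rewrite Zr_eqN // (negPf d0) /= => /eqP dE; case: dh.
  by apply: val_inj; rewrite [val h]hE.
by rewrite /letter_weight /= hE eqxx ltnn andbF !mulr1 mulrDr mulr1.
Qed.

Lemma sum_pair_weight i j : i != j ->
  \sum_(d : 'Z_r) letter_weight i (j, d) * letter_weight j (i, - d)
    = b + (r%:R - 1) * c ^+ r.
Proof.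
move=> ij; rewrite (bigD1 0) //=; congr (_ + _).
  (* In colour 0 exactly one of the two letters, the smaller, is an excedance. *)
  rewrite oppr0 /letter_weight /= (negPf ij) eq_sym (negPf ij) /=.
  rewrite !expr0 !mul1r !mulr1 -exprD.
  by case: ltngtP ij => //= /val_inj ->; rewrite eqxx.
transitivity (\sum_(d : 'Z_r | d != 0) c ^+ r).
  apply: eq_bigr => d d0; rewrite /letter_weight /= oppr_eq0 (negPf d0) (negPf ij).
  rewrite eq_sym (negPf ij) /= !mul1r -exprD -[X in (_ + X)%N]/(nat_of_ord (- d)).
  by rewrite val_Zr_opp // (negPf d0) subnKC // ltnW ?Zr_lt.
rewrite sumr_const cardC1 card_Zr // -[LHS]mulr_natl. congr (_ * _).
by rewrite -subn1 natrB // ltnW.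
Qed.

End Weights.

(** * The generating polynomial: recurrence and closed form *)

Lemma f_invE r p n : (1 < r)%N -> ~~ odd r -> (p %| r./2)%N ->
  f_inv r p n%:Z
    = invol_poly (u * (1 + w ^+ r./2)) (v + (r%:R - 1) * w ^+ r) n.
Proof.
move=> r_gt1 r_even p_dvd; rewrite /f_inv.
rewrite -[n in RHS]card_ord -cardsT -(@invol_sumE 'I_n 'Z_r _ (letter_weight u v w)).
- rewrite /invol_sum.
  rewrite (eq_bigl (fun e => e \in @letter_values r n @: Irpn r p n)); last first.
    by move=> e; rewrite letter_values_Irpn // inE.
  rewrite big_imset; last exact: letter_values_inj.
  apply: eq_bigr => s _; rewrite -prod_letter_weight.
  by apply: eq_bigl => i; rewrite inE.
- by move=> i; apply: sum_fixed_weight.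
- by move=> i j; apply: sum_pair_weight.
Qed.

Lemma matching_number_trinomial n k : (k.*2 <= n)%N ->
  matching_number rat n k = k`!%:R * trinomial n k k (n - k.*2) / 2 ^+ k.
Proof.
have fact_neq0 m : m`!%:R != 0 :> rat.
  by rewrite Num.Theory.pnatr_eq0 -lt0n fact_gt0.
move=> kn; rewrite /matching_number /trinomial kn; field.
by rewrite !fact_neq0 expf_neq0.
Qed.

Theorem corollary5p6 (r p : nat) (r_gt0 : (0 < r)%N) (r_even : ~~ odd r)
    (p_gt1 : (1 < p)%N) (p_dvd : (p %| r./2)%N) (n : nat) (n_gt0 : (1 <= n)%N) :
  f_inv r p n%:Z
    = u * (1 + w ^+ r./2) * f_inv r p (n%:Z - 1)
      + (n%:R - 1) * (v + (r%:R - 1) * w ^+ r) * f_inv r p (n%:Z - 2)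
  /\
  f_inv r p n%:Z
    = \sum_(uphalf n <= j < n.+1)
        ((n - j)`!%:R * trinomial n (n - j) (n - j) (2 * j - n) / 2 ^+ (n - j))
        *: (u ^+ (2 * j - n) * (v + (r%:R - 1) * w ^+ r) ^+ (n - j)
            * (1 + w ^+ r./2) ^+ (2 * j - n)).
Proof.
have r_gt1 : (1 < r)%N by move: r_gt0 r_even; lia.
split.
  case: n n_gt0 => [//|m] _.
  have -> : m.+1%:Z - 1 = m%:Z by lia.
  have -> : m.+1%:R - 1 = m%:R :> {mpoly rat[3]} by rewrite -natr1 addrK.
  rewrite !f_invE //=; congr (_ + _).
  (* For [n = 1] the factor [n - 1] kills the second term. *)
  case: m => [|k]; first by rewrite !mul0r.
  have -> : k.+2%:Z - 2 = k%:Z by lia.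
  by rewrite f_invE.
rewrite f_invE // (invol_poly_closed _ _ (ltnSn n./2)).
(* Substitute [j = n - k], where [k] counts the 2-cycles and runs from 0 to [n./2]. *)
rewrite big_nat_rev -[in RHS](add0n (uphalf n)) big_addn big_mkord.
have -> : (n.+1 - uphalf n)%N = n./2.+1 by rewrite uphalf_half; lia.
apply: eq_bigr => k _.
have kn : (k.*2 <= n)%N by have := ltn_ord k; lia.
have -> : (uphalf n + n.+1 - (k + uphalf n).+1 = n - k)%N by lia.
rewrite subKn; last by lia.
have -> : (2 * (n - k) - n = n - k.*2)%N by lia.
rewrite matching_number_trinomial // exprMn; congr (_ *: _); apply: mulrAC.
Qed.
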